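(* Let $\mu>0$, $\lambda\in(0,1)$, $\alpha_0,\alpha_1,\alpha_2\in\mathbb{R}$, $\alpha^+=(\alpha_1+\alpha_2)/2$, $\alpha^-=(\alpha_1-\alpha_2)/2$, with $\sin(2\alpha^+)\neq0$. Consider the two-agent beacon-referenced cyclic constant bearing pursuit dynamics $\dot\xi=f(\xi)$, $\xi=(\kappa_1,\kappa_2,\rho,\kappa_{1b},\kappa_{2b},\rho_{1b},\rho_{2b})$, given by $$\begin{aligned} \dot\rho&=-(\cos\kappa_1+\cos\kappa_2),\\ \dot\kappa_i&=-\mu\big[(1-\lambda)\sin(\kappa_i-\alpha_i)+\lambda\sin(\kappa_{ib}-\alpha_0)\big]+\tfrac{\lambda}{\rho}(\sin\kappa_1+\sin\kappa_2),\\ \dot\rho_{ib}&=-\cos\kappa_{ib},\\ \dot\kappa_{ib}&=\dot\kappa_i-\tfrac1\rho(\sin\kappa_1+\sin\kappa_2)+\tfrac1{\rho_{ib}}\sin\kappa_{ib},\qquad i=1,2, \end{aligned}$$ with $\rho,\rho_{1b},\rho_{2b}>0$. Let $\bar\xi$ be a two-agent circling equilibrium of one of the four kinds Type 1 CCW, Type 1 CW, Type 2 CCW, Type 2 CW defined in the context (so the corresponding existence condition holds), and let $A=Df(\bar\xi)$ be the $7\times7$ Jacobian. Then $A$ has two pure imaginary eigenvalues resulting from the constraint equation $$\rho\,\mathbb{I}_2-\rho_{1b}R(\kappa_{1b}-\kappa_1)-\rho_{2b}R(\kappa_{2b}-\kappa_2)=0,$$ and the remaining five eigenvalues (counted with algebraic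 multiplicity) all have real parts less than zero if and only if - $\sin\alpha_0>0$ and $\sin\alpha^+>0$, in the Type 1 CCW case; - $\sin\alpha_0<0$ and $\sin\alpha^+<0$, in the Type 1 CW case; - $\sin\alpha_0>0$ and $\sin\alpha^+<0$, in the Type 2 CCW case; - $\sin\alpha_0<0$ and $\sin\alpha^+>0$, in the Type 2 CW case.
   Context: $R(\vartheta)=\begin{bmatrix}\cos\vartheta&-\sin\vartheta\\ \sin\vartheta&\cos\vartheta\end{bmatrix}$ and $\mathbb{I}_2$ is the $2\times 2$ identity. Two unit-speed planar agents pursue each other and reference a fixed beacon; $\rho$ is the inter-agent distance, $\rho_{ib}$ the distance from agent $i$ to the beacon, $\kappa_i$ the angle from the heading of agent $i$ to the direction of the other agent, and $\kappa_{ib}$ the angle from the heading of agent $i$ to the direction of the beacon. Geometric consistency is the matrix constraint in the claim, equivalently $g_1(\xi)=g_2(\xi)=0$ with $g_1(\xi)=\rho-\rho_{1b}\cos(\kappa_{1b}-\kappa_1)-\rho_{2b}\cos(\kappa_{2b}-\kappa_2)$ and $g_2(\xi)=\rho_{1b}\sin(\kappa_{1b}-\kappa_1)+\rho_{2b}\sin(\kappa_{2b}-\kappa_2)$. The set $\{g_1=g_2=0\}$ is invariant under the dynamics. That two eigenvalues of $A$ ''result from the constraint equation'' means that they are the eigenvalues of the linear map induced by $A$ on the two-dimensional quotient $\mathbb{R}^7/\ker D(g_1,g_2)(\bar\xi)$, i.e. of the $2\times2$ diagonal block belonging to $(g_1,g_2)$ when these are used as the last two local coordinates. The two-agent circling equilibria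 (angles modulo $2\pi$, $i=1,2$): Type 1 exists when $\cos\alpha^->0$ and $\lambda\cos\alpha_0+(1-\lambda)\cos\alpha^+>0$, with $\rho=\dfrac{2\lambda\cos\alpha^-}{\mu\lambda\cos\alpha_0+\mu(1-\lambda)\cos\alpha^+}$, $\rho_{ib}=\dfrac{\lambda}{\mu\lambda\cos\alpha_0+\mu(1-\lambda)\cos\alpha^+}$, and - Type 1 CCW: $\kappa_{ib}=\frac\pi2$, $\kappa_1=\frac\pi2+\alpha^-$, $\kappa_2=\frac\pi2-\alpha^-$; - Type 1 CW: $\kappa_{ib}=-\frac\pi2$, $\kappa_1=-\frac\pi2+\alpha^-$, $\kappa_2=-\frac\pi2-\alpha^-$. Type 2 exists when $\cos\alpha^-<0$ and $\lambda\cos\alpha_0-(1-\lambda)\cos\alpha^+>0$, with $\rho=\dfrac{-2\lambda\cos\alpha^-}{\mu\lambda\cos\alpha_0-\mu(1-\lambda)\cos\alpha^+}$, $\rho_{ib}=\dfrac{\lambda}{\mu\lambda\cos\alpha_0-\mu(1-\lambda)\cos\alpha^+}$, and - Type 2 CW: $\kappa_{ib}=-\frac\pi2$, $\kappa_1=\frac\pi2+\alpha^-$, $\kappa_2=\frac\pi2-\alpha^-$; - Type 2 CCW: $\kappa_{ib}=\frac\pi2$, $\kappa_1=-\frac\pi2+\alpha^-$, $\kappa_2=-\frac\pi2-\alpha^-$. *)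

(* Defs.v *)
From mathcomp Require Import all_boot all_order all_algebra.
From mathcomp Require Import mxrepresentation.
From mathcomp Require Import reals normedtype derive trigo.
From mathcomp.real_closed Require Import complex.

Set Implicit Arguments.
Unset Strict Implicit.
Unset Printing Implicit Defensive.

Import Order.TTheory GRing.Theory Num.Theory.
Import numFieldNormedType.Exports.

Local Open Scope ring_scope.

(** Row vectors are used for states, so that ['J f x] acts on the right: the
    differential of [f] at [x] is [v |-> v *m 'J f x], and ['J f x] is the
    transpose of the Jacobian acting on column vectors. *)

Section LinearAlgebra.
Variable R : realType.

(** [s] lists the complex eigenvalues of the real matrix [M], each repeated
    according to its algebraic multiplicity. *)
Definition spectrum n (M : 'M[R]_n) (s : seq R[i]) : Prop :=
  char_poly (map_mx (real_complex R) M) = \prod_(z <- s) ('X - z%:P).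

(** Matrix of the endomorphism of R^n / U induced by [M], where R^n / U is
    identified with row vectors of length [\rank (cokermx U)]; meaningful when
    [stablemx U M]. *)
Definition quotient_endo n (U M : 'M[R]_n) : 'M[R]_(\rank (cokermx U)) :=
  in_factmod U (val_factmod (1%:M : 'M_(\rank (cokermx U))) *m M).

Definition pure_imaginary (z : R[i]) : Prop :=
  complex.Re z = 0 /\ complex.Im z != 0.

End LinearAlgebra.

Section Pursuit.
Variable R : realType.
Implicit Types x : 'rV[R]_7.

Definition kappa1  x : R := x ord0 (@Ordinal 7 0 isT).
Definition kappa2  x : R := x ord0 (@Ordinal 7 1 isT).
Definition rho     x : R := x ord0 (@Ordinal 7 2 isT).
Definition kappa1b x : R := x ord0 (@Ordinal 7 3 isT).
Definition kappa2b x : R := x ord0 (@Ordinal 7 4 isT).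
Definition rho1b   x : R := x ord0 (@Ordinal 7 5 isT).
Definition rho2b   x : R := x ord0 (@Ordinal 7 6 isT).

(** The dynamics are meant on [rho, rho1b, rho2b > 0]; elsewhere the field is
    totalized by the convention [0^-1 = 0]. *)
Definition pursuit_field (mu lambda alpha0 alpha1 alpha2 : R) x : 'rV[R]_7 :=
  let S := sin (kappa1 x) + sin (kappa2 x) in
  let dkappa alpha k kb :=
    - (mu * ((1 - lambda) * sin (k - alpha) + lambda * sin (kb - alpha0)))
    + lambda / rho x * S in
  let dkappab alpha k kb rb :=
    dkappa alpha k kb - (rho x)^-1 * S + rb^-1 * sin kb in
  \row_(j < 7) nth 0
    [:: dkappa alpha1 (kappa1 x) (kappa1b x);
        dkappa alpha2 (kappa2 x) (kappa2b x);
        - (cos (kappa1 x) + cos (kappa2 x));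
        dkappab alpha1 (kappa1 x) (kappa1b x) (rho1b x);
        dkappab alpha2 (kappa2 x) (kappa2b x) (rho2b x);
        - cos (kappa1b x);
        - cos (kappa2b x)] j.

Definition rotation (t : R) : 'M[R]_2 :=
  \matrix_(i < 2, j < 2)
    nth 0 (nth [::] [:: [:: cos t; - sin t]; [:: sin t; cos t]] i) j.

Definition constraint_mx x : 'M[R]_2 :=
  rho x *: 1%:M - rho1b x *: rotation (kappa1b x - kappa1 x)
                - rho2b x *: rotation (kappa2b x - kappa2 x).

Definition g1 x : R :=
  rho x - rho1b x * cos (kappa1b x - kappa1 x)
        - rho2b x * cos (kappa2b x - kappa2 x).

Definition g2 x : R :=
  rho1b x * sin (kappa1b x - kappa1 x) + rho2b x * sin (kappa2b x - kappa2 x).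

Definition constraint x : 'rV[R]_2 := \row_(j < 2) nth 0 [:: g1 x; g2 x] j.

Lemma constraint_mx_eq0 x : constraint_mx x = 0 <-> constraint x = 0.
Proof.
have mxE2 : constraint_mx x =
    \matrix_(i < 2, j < 2)
      nth 0 (nth [::] [:: [:: g1 x; g2 x]; [:: - g2 x; g1 x]] i) j.
  apply/matrixP => -[[|[|i]] Hi] // -[[|[|j]] Hj] //; rewrite !mxE /=.
  - by rewrite mulr1.
  - by rewrite mulr0 sub0r !mulrN !opprK.
  - by rewrite mulr0 sub0r opprD.
  - by rewrite mulr1.
rewrite mxE2; split=> /matrixP g0; apply/matrixP.
- by move=> i j; have := g0 ord0 j; rewrite !mxE.
- have := g0 ord0 ord0; have := g0 ord0 ord_max; rewrite !mxE /= => g20 g10.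
  by move=> -[[|[|i]] Hi] // -[[|[|j]] Hj] //; rewrite !mxE /= ?g10 ?g20 ?oppr0.
Qed.

(** Congruence of angles modulo 2 pi. *)
Definition eq_angle (a b : R) : Prop := exists k : int, a = b + 2 * pi * k%:~R.

Inductive circling := Type1CCW | Type1CW | Type2CCW | Type2CW.

Definition circling_exists (c : circling)
    (lambda alpha0 alphap alpham : R) : Prop :=
  match c with
  | Type1CCW | Type1CW =>
      0 < cos alpham /\ 0 < lambda * cos alpha0 + (1 - lambda) * cos alphap
  | Type2CCW | Type2CW =>
      cos alpham < 0 /\ 0 < lambda * cos alpha0 - (1 - lambda) * cos alphap
  end.

Definition circling_rho (c : circling)
    (mu lambda alpha0 alphap alpham : R) : R :=
  match c with
  | Type1CCW | Type1CW =>
      2 * lambda * cos alpham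
      / (mu * lambda * cos alpha0 + mu * (1 - lambda) * cos alphap)
  | Type2CCW | Type2CW =>
      - (2 * lambda * cos alpham)
      / (mu * lambda * cos alpha0 - mu * (1 - lambda) * cos alphap)
  end.

Definition circling_rhob (c : circling)
    (mu lambda alpha0 alphap : R) : R :=
  match c with
  | Type1CCW | Type1CW =>
      lambda / (mu * lambda * cos alpha0 + mu * (1 - lambda) * cos alphap)
  | Type2CCW | Type2CW =>
      lambda / (mu * lambda * cos alpha0 - mu * (1 - lambda) * cos alphap)
  end.

Definition circling_kappab (c : circling) : R :=
  match c with
  | Type1CCW | Type2CCW => pi / 2
  | Type1CW | Type2CW => - (pi / 2)
  end.

(** [kappa_1] and [kappa_2] are this angle plus, resp. minus, [alpha^-]. *)
Definition circling_kappa (c : circling) : R :=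
  match c with
  | Type1CCW | Type2CW => pi / 2
  | Type1CW | Type2CCW => - (pi / 2)
  end.

Definition circling_equilibrium (c : circling)
    (mu lambda alpha0 alpha1 alpha2 : R) x : Prop :=
  let alphap := (alpha1 + alpha2) / 2 in
  let alpham := (alpha1 - alpha2) / 2 in
  [/\ circling_exists c lambda alpha0 alphap alpham,
      rho x = circling_rho c mu lambda alpha0 alphap alpham,
      rho1b x = circling_rhob c mu lambda alpha0 alphap
        /\ rho2b x = circling_rhob c mu lambda alpha0 alphap,
      eq_angle (kappa1b x) (circling_kappab c)
        /\ eq_angle (kappa2b x) (circling_kappab c)
    & eq_angle (kappa1 x) (circling_kappa c + alpham)
        /\ eq_angle (kappa2 x) (circling_kappa c - alpham)].

End Pursuit.

(* Main.v *)
(** At a circling equilibrium let e = sin kappa_ib, let d be the sine of the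
    angle from which kappa_1 and kappa_2 differ by +- alpha^- (e^2 = d^2 = 1),
    and let w = 1 / rho_ib.  In row convention the differential G of (g1, g2)
    satisfies A G = G M, where M is w times a rotation by a right angle; this
    gives the eigenvalues +- i w on the quotient by ker G.  The functionals
    kappa_1 - kappa_2, kappa_1b - kappa_2b, rho_1b - rho_2b span an invariant
    space, and so do kappa_1 + kappa_2 and rho modulo these and the constraints.
    With p = mu (1 - lambda) d sin alpha^+ and q = mu lambda e sin alpha_0 the
    characteristic polynomial is therefore
    (X^2 + w^2) (X^3 + (p + q) X^2 + w^2 X + p w^2)
      (X^2 + (p + q) X + lambda w^2),
    and the Routh-Hurwitz condition on the cubic is exactly p > 0 and q > 0. *)
Require Import Defs.
From mathcomp Require Import all_boot all_order all_algebra.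
From mathcomp Require Import mxrepresentation.
From mathcomp Require Import reals normedtype derive trigo.
From mathcomp.real_closed Require Import complex.
From mathcomp Require Import boolp functions topology.
From mathcomp Require Import ring lra.

Import Order.TTheory GRing.Theory Num.Theory.
Import numFieldNormedType.Exports.

Local Open Scope ring_scope.

(** * Characteristic polynomials under intertwining, in blocks and on quotients *)

(** Take determinants in (X - A) P = P (X - B) and cancel the nonzero det P. The equation [m = n] is
    a hypothesis because the size of a quotient is a rank, equal to the wanted number only
    propositionally. *)
Lemma char_poly_intertwine (F : fieldType) m n (P : 'M[F]_(m, n)) A B :
  m = n -> row_free P -> A *m P = P *m B -> char_poly A = char_poly B.
Proof.
move=> mn; case: _ / mn in P B *.
rewrite row_free_unit => Pu AP.
have eqp : char_poly_mx A *m map_mx polyC P = map_mx polyC P *m char_poly_mx B.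
  rewrite /char_poly_mx mulmxBl mulmxBr -!map_mxM AP.
  by rewrite scalar_mxC.
have/(congr1 determinant) := eqp.
rewrite !det_mulmx mulrC => /mulfI; apply.
by rewrite det_map_mx polyC_eq0 -unitfE -unitmxE.
Qed.

Lemma char_poly_ublock (F : comNzRingType) n1 n2 (A : 'M[F]_n1) B
    (D : 'M[F]_n2) :
  char_poly (block_mx A B 0 D) = char_poly A * char_poly D.
Proof.
rewrite /char_poly /char_poly_mx map_block_mx map_mx0 scalar_mx_block.
by rewrite opp_block_mx add_block_mx oppr0 addr0 det_ublock.
Qed.

(** Full column rank of [G] makes v |-> v G an identification of R^n / ker G with R^k, and A G = G M
    says that [A] acts there as [M]. *)
Lemma factor_kermx (R : realType) n k (A : 'M[R]_n) (G : 'M[R]_(n, k)) M :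
  row_free G^T -> A *m G = G *m M ->
  [/\ stablemx (kermx G) A, \rank (cokermx (kermx G)) = k
    & char_poly (quotient_endo (kermx G) A) = char_poly M].
Proof.
move=> Gfree AG.
have rG : \rank G = k by apply/eqP; rewrite -mxrank_tr.
have rK : \rank (cokermx (kermx G)) = k.
  by rewrite mxrank_coker mxrank_ker subKn // rank_leq_row.
split=> //.
  by apply/sub_kermxP; rewrite -mulmxA AG mulmxA mulmx_ker mul0mx.
(* A vector and the representative of its class differ by an element of ker G, so they have the same
   image under [G]. *)
have valK m (W : 'M_(m, n)) :
    val_factmod (in_factmod (kermx G) W) *m G = W *m G.
  rewrite -{2}(add_sub_fact_mod (kermx G) W) mulmxDl.
  have /sub_kermxP -> := val_submodP (in_submod (kermx G) W).
  by rewrite add0r.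
apply: (char_poly_intertwine _ _ _ (val_factmod 1%:M *m G)) => //.
  (* By [valK] this product is [G] itself, so its right factor has rank at least k. *)
  have : (\rank (in_factmod (kermx G) 1%:M *m (val_factmod 1%:M *m G))
          <= \rank (@val_factmod _ n (kermx G) _ 1%:M *m G))%N.
    exact: mxrankM_maxr.
  rewrite mulmxA -val_factmodE valK mul1mx rG => le.
  rewrite /row_free eqn_leq rank_leq_row /=; apply: leq_trans le.
  by rewrite rK.
by rewrite mulmxA -val_factmodE valK -mulmxA AG mulmxA.
Qed.

(** * Explicit characteristic polynomials in sizes 2 and 3 *)

Definition mx_rows (T : nmodType) m n (s : seq (seq T)) : 'M[T]_(m, n) :=
  \matrix_(i < m, j < n) nth 0 (nth [::] s i) j.

Lemma char_poly_rows2 (T : comNzRingType) (a b c d : T) :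
  char_poly (mx_rows T 2 2 [:: [:: a; b]; [:: c; d]]) =
  ('X - a%:P) * ('X - d%:P) - (b * c)%:P.
Proof.
rewrite /mx_rows /char_poly (expand_det_row _ ord0) !big_ord_recl big_ord0.
rewrite addr0.
rewrite /cofactor !det_mx11 !mxE /= /bump /= ?mxE /=.
by rewrite polyCM; ring.
Qed.

Lemma char_poly_rows3 (T : comNzRingType) (a b c d e f g h i : T) :
  char_poly (mx_rows T 3 3 [:: [:: a; b; c]; [:: d; e; f]; [:: g; h; i]]) =
  ('X - a%:P) * (('X - e%:P) * ('X - i%:P) - f%:P * h%:P)
  - b%:P * (d%:P * ('X - i%:P) + f%:P * g%:P)
  - c%:P * (d%:P * h%:P + ('X - e%:P) * g%:P).
Proof.
rewrite /mx_rows /char_poly (expand_det_row _ ord0) !big_ord_recl big_ord0.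
rewrite addr0.
rewrite /cofactor !(expand_det_row _ ord0) !big_ord_recl !big_ord0 !addr0.
rewrite /cofactor !det_mx11 !mxE /= /bump /= ?mxE /=.
ring.
Qed.

(** * Spectra, and half-plane location of roots of quadratics and of the cubic *)

Section Roots.
Variable R : realType.
Let toC := real_complex R.

Lemma spectrum_exists n (A : 'M[R]_n) : exists s : n.-tuple R[i], spectrum A s.
Proof.
have [s sE] := closed_field_poly_normal (char_poly (map_mx toC A)).
rewrite (monicP (char_poly_monic _)) scale1r in sE.
have ss : size s == n.
  by rewrite -eqSS -(size_prod_XsubC s id) -sE size_char_poly.
by exists (Tuple ss).
Qed.

Lemma mem_spectrum n (A : 'M[R]_n) s z : spectrum A s ->
  (z \in s) = root (map_poly toC (char_poly A)) z.
Proof. by rewrite map_char_poly => ->; rewrite root_prod_XsubC. Qed.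

Lemma horner_map_quadratic (u v : R) z :
  (map_poly toC ('X^2 + u%:P * 'X + v%:P)).[z] = z ^+ 2 + toC u * z + toC v.
Proof.
by rewrite !rmorphD rmorphM /= map_polyXn map_polyX !map_polyC !hornerE.
Qed.

(** The imaginary part of the equation is y (2 x + u) = 0. For x >= 0 it forces y = 0, and then x^2
    + u x + v > 0. *)
Lemma root_quadratic_lt0 (u v : R) (z : R[i]) : 0 < u -> 0 < v ->
  root (map_poly toC ('X^2 + u%:P * 'X + v%:P)) z -> complex.Re z < 0.
Proof.
move=> u0 v0; rewrite /root horner_map_quadratic.
case: z => x y; rewrite ?expr2 => /eqP [] /= re im.
rewrite ltNge /=; apply/negP => x0.
have /eqP : y * (2 * x + u) = 0 by rewrite -im; ring.
rewrite mulf_eq0 => /orP [/eqP y0|/eqP]; last by nra.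
by rewrite y0 in re; nra.
Qed.

(** Quadratic formula, with the square root of the discriminant chosen of nonnegative real part: the
    root then has real part at least - u / 2. *)
Lemma root_quadratic_ge0 (u v : R) : u <= 0 ->
  exists2 z : R[i], root (map_poly toC ('X^2 + u%:P * 'X + v%:P)) z
                  & 0 <= complex.Re z.
Proof.
move=> u0.
have [y yE yRe] : exists2 y : R[i],
    y ^+ 2 = toC (u ^+ 2 - 4 * v) & 0 <= complex.Re y.
  have [y0|y0] := lerP 0 (complex.Re (sqrtc (toC (u ^+ 2 - 4 * v)))).
    by exists (sqrtc (toC (u ^+ 2 - 4 * v))); rewrite ?sqr_sqrtc.
  exists (- sqrtc (toC (u ^+ 2 - 4 * v))); first by rewrite sqrrN sqr_sqrtc.
  by move: y0; case: (sqrtc _) => a b /=; lra.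
exists ((y - toC u) / 2).
  rewrite /root horner_map_quadratic.
  have -> : ((y - toC u) / 2) ^+ 2 + toC u * ((y - toC u) / 2) + toC v =
      (y ^+ 2 - (toC u ^+ 2 - 4 * toC v)) / 4 by field.
  by rewrite yE /toC !(rmorphB, rmorphM, rmorphXn, rmorph_nat) /= subrr mul0r.
have -> : (2 : R[i])^-1 = toC 2^-1.
  by rewrite -(rmorph_nat (real_complex R)) -fmorphV.
by case: y yRe {yE} => a b /= a0; lra.
Qed.

Lemma horner_map_cubic (a b c : R) z :
  (map_poly toC ('X^3 + a%:P * 'X^2 + b%:P * 'X + c%:P)).[z] =
  z ^+ 3 + toC a * z ^+ 2 + toC b * z + toC c.
Proof.
rewrite !rmorphD /= !rmorphM /= !map_polyC !map_polyX !hornerE.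
by rewrite !exprS expr0 mulr1 !mulrA.
Qed.

(** Characteristic polynomial of [difference_block]. For w != 0 the Routh-Hurwitz inequality (p + q)
    w^2 > p w^2 reduces to q > 0. *)
Definition cubic (p q w : R) : {poly R} :=
  'X^3 + (p + q)%:P * 'X^2 + (w ^+ 2)%:P * 'X + (p * w ^+ 2)%:P.

Lemma cubicE p q w : cubic p q w =
  ('X^2 + (w ^+ 2)%:P) * ('X + p%:P) + q%:P * 'X^2.
Proof. by rewrite /cubic polyCD polyCM; ring. Qed.

(** Sufficiency: for a root x + i y with x >= 0, the imaginary part of the equation leaves y = 0 or
    one value of y^2, and in both cases the real part of the equation cannot vanish. Necessity: p <=
    0 gives a nonnegative real root; p > 0 >= q gives a quadratic factor with a root of nonnegative
    real part. *)
Lemma cubic_roots p q w : 0 < w ->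
  (forall z, root (map_poly toC (cubic p q w)) z -> complex.Re z < 0) <->
  0 < p /\ 0 < q.
Proof.
move=> w0; have w2 : 0 < w ^+ 2 by rewrite exprn_gt0.
have hE t : (cubic p q w).[t] = (t ^+ 2 + w ^+ 2) * (t + p) + q * t ^+ 2.
  by rewrite cubicE !hornerE.
split=> [H|[p0 q0] z]; last first.
  rewrite /root horner_map_cubic.
  case: z => x y; rewrite !exprS expr0 => /eqP [] /= re im.
  rewrite ltNge /=; apply/negP => x0.
  have /eqP : y * (3 * x^+2 - y ^+ 2 + 2 * (p + q) * x + w ^+ 2) = 0.
    by rewrite -im; ring.
  rewrite mulf_eq0 => /orP [/eqP y0|/eqP y2].
    have : x ^+ 3 + (p + q) * x ^+ 2 + w ^+ 2 * x + p * w ^+ 2 = 0.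
      by rewrite -re y0; ring.
    have : 0 < p * w ^+ 2 by rewrite mulr_gt0.
    have : 0 <= x ^+ 3 by rewrite exprn_ge0.
    have : 0 <= (p + q) * x ^+ 2 by rewrite mulr_ge0 ?exprn_ge0 //; lra.
    have : 0 <= w ^+ 2 * x by rewrite mulr_ge0 // ltW.
    lra.
  (* The real part after eliminating y^2: no term is positive and the last is negative. *)
  have : - 8 * x ^+ 3 - 8 * ((p + q) * x ^+ 2) - 2 * ((p + q) ^+ 2 * x)
         - 2 * (w ^+ 2 * x) - q * w ^+ 2 = 0.
    have -> : q = (p + q) - p by ring.
    have y2E : y ^+ 2 = 3 * x^+2 + 2 * (p + q) * x + w ^+ 2 by lra.
    have <- : x ^+ 3 - 3 * x * y ^+ 2 + (p + q) * (x ^+ 2 - y ^+ 2)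
        + w ^+ 2 * x + p * w ^+ 2 = 0.
      by rewrite -re; ring.
    rewrite y2E; ring.
  have : 0 < q * w ^+ 2 by rewrite mulr_gt0.
  have : 0 <= x ^+ 3 by rewrite exprn_ge0.
  have : 0 <= (p + q) * x ^+ 2 by rewrite mulr_ge0 ?exprn_ge0 //; lra.
  have : 0 <= (p + q) ^+ 2 * x by rewrite mulr_ge0 ?exprn_ge0 //; lra.
  have : 0 <= w ^+ 2 * x by rewrite mulr_ge0 // ltW.
  lra.
have Hr t : root (cubic p q w) t -> t < 0.
  by rewrite -(fmorph_root toC) => /H.
have p0 : 0 < p.
  rewrite ltNge; apply/negP => p0.
  (* The value at 0 is p w^2 <= 0. The right endpoint m satisfies m + p = 1 + |q|, so (m^2 + w^2) (m
     + p) outweighs q m^2 there. *)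
  have [||t /andP [t0 _] /Hr] := @poly_ivt _ (cubic p q w) 0 (1 - p + `|q|).
  - have := normr_ge0 q; lra.
  - rewrite !hE; apply/andP; split; first by nra.
    set m := 1 - p + _; have -> : m + p = 1 + `|q| by rewrite /m; ring.
    have m2 := sqr_ge0 m.
    have q1 := ler_norm (- q); rewrite normrN in q1.
    have q2 := normr_ge0 q.
    have : 0 <= (`|q| + q) * m ^+ 2 by rewrite mulr_ge0 //; lra.
    have : 0 <= w ^+ 2 * `|q| by rewrite mulr_ge0 // ltW.
    nra.
  - lra.
split=> //; rewrite ltNge; apply/negP => q0.
(* The value at -p is q p^2 <= 0, whence a real root t in [-p, 0]; the cofactor
   X^2 + u X + v then satisfies u (t^2 + w^2) = q w^2 <= 0. *)
have [||t /andP [tp t0] rt] := @poly_ivt _ (cubic p q w) (- p) 0.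
- lra.
- by rewrite !hE; apply/andP; split; nra.
have tE : (t ^+ 2 + w ^+ 2) * (t + p) + q * t ^+ 2 = 0.
  by rewrite -hE; apply/eqP.
pose u := p + q + t; pose v := w ^+ 2 + t * u.
have u0 : u <= 0.
  have t2 := sqr_ge0 t.
  have : u * (t ^+ 2 + w ^+ 2) = q * w ^+ 2.
    transitivity ((t ^+ 2 + w ^+ 2) * (t + p) + q * t ^+ 2 + q * w ^+ 2).
      by rewrite /u; ring.
    by rewrite tE; ring.
  by move=> e; rewrite leNgt; apply/negP => u0; nra.
have fE : cubic p q w = ('X - t%:P) * ('X^2 + u%:P * 'X + v%:P).
  (* Division by X - t; the remainder is the value of the cubic at t. *)
  have -> : cubic p q w = ('X - t%:P) * ('X^2 + u%:P * 'X + v%:P)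
      + ((t ^+ 2 + w ^+ 2) * (t + p) + q * t ^+ 2)%:P.
    rewrite /cubic /v /u !(polyCD, polyCM, polyC_exp); ring.
  by rewrite tE polyC0 addr0.
have [z rz] := root_quadratic_ge0 u v u0; rewrite leNgt => /negP; apply.
by apply: H; rewrite fE rmorphM rootM rz orbT.
Qed.
End Roots.

(** * Differentials of scalar expressions and of row-valued maps *)

Section Differentials.
Variables (R : realType) (V : normedModType R) (x : V).
Implicit Types f g df dg : V -> R.

Lemma eq_is_diff f g df : g =1 f -> is_diff x f df -> is_diff x g df.
Proof. by move=> /funext ->. Qed.

(** This rule and the next ones are stated for explicit abstractions, so that [diff_tac] can select
    them by the head symbol of the body. *)
Lemma is_diff_addf f g df dg : is_diff x f df -> is_diff x g dg ->
  is_diff x (fun y => f y + g y) (fun v => df v + dg v).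
Proof. exact: is_diffD. Qed.

Lemma is_diff_oppf f df : is_diff x f df ->
  is_diff x (fun y => - f y) (fun v => - df v).
Proof. exact: is_diffN. Qed.

Lemma is_diff_cstf (a : R) : is_diff x (fun _ : V => a) (fun=> 0).
Proof. exact: is_diff_cst. Qed.

Lemma is_diff_mulf f g df dg : is_diff x f df -> is_diff x g dg ->
  is_diff x (fun y => f y * g y) (fun v => f x * dg v + g x * df v).
Proof. exact: is_diffM. Qed.

Lemma is_diff_invf f df : f x != 0 -> is_diff x f df ->
  is_diff x (fun y => (f y)^-1) (fun v => - (f x ^- 2) * df v).
Proof.
move=> fx0 dfx; apply: DiffDef; first by apply: differentiableV.
by rewrite diffV // diff_val.
Qed.

Lemma is_diff_derive f df (h : R -> R) (h' : R) : is_derive (f x) 1 h h' ->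
  is_diff x f df -> is_diff x (fun y => h (f y)) (fun v => h' * df v).
Proof.
move=> hd dfx.
have dh : differentiable h (f x) by apply/derivable1_diffP.
have dhf := differentiableP dh.
have dc := @is_diff_comp _ _ _ _ _ _ _ _ _ dfx dhf.
apply: (@is_diff_eq _ _ _ _ _ _ _ dc).
by apply/funext => v /=; rewrite diff1E // derive1E derive_val mulrC.
Qed.

Lemma is_diff_sinf f df : is_diff x f df ->
  is_diff x (fun y => sin (f y)) (fun v => cos (f x) * df v).
Proof. exact: is_diff_derive. Qed.

Lemma is_diff_cosf f df : is_diff x f df ->
  is_diff x (fun y => cos (f y)) (fun v => - sin (f x) * df v).
Proof. exact: is_diff_derive. Qed.

(** Differentiability comes from writing [F] as the sum of its coordinates times basis vectors; the
    differential is then a directional derivative, taken entry by entry. *)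
Lemma is_diff_row n (F : V -> 'rV[R]_n) (dF : 'I_n -> V -> R) :
  (forall j, is_diff x (fun y => F y ord0 j) (dF j)) ->
  differentiable F x /\ forall v, 'd F x v = \row_j dF j v.
Proof.
move=> dFj.
have dF_ : differentiable F x.
  have -> : F = \sum_(j < n) (fun y => F y ord0 j *: delta_mx 0 j).
    by apply/funext => y; rewrite fct_sumE [LHS]row_sum_delta.
  by apply: differentiable_sum => j; apply: differentiableZl; case: (dFj j).
split=> // v; rewrite -deriveE // derive_mx; last exact: diff_derivable.
apply/rowP => j; rewrite !mxE deriveE; last by case: (dFj j).
by rewrite diff_val.
Qed.

End Differentials.

Lemma is_diff_coord (R : realType) n (x : 'rV[R]_n) (j : 'I_n) :
  is_diff x (fun y : 'rV[R]_n => y ord0 j) (fun v => v ord0 j).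
Proof.
have dc := @differentiable_coord R 1 n x ord0 j.
apply: DiffDef => //; apply/funext => v; rewrite -deriveE //.
have := @derive_mx R 'rV[R]_n 1 n id x v (@derivable_id _ _ _ _).
by rewrite derive_id => /rowP /(_ j); rewrite mxE => <-.
Qed.

(** Describes a Jacobian through its action on a row vector, which avoids listing matrix entries. *)
Lemma mul_jacobian (R : realType) m n (F : 'rV[R]_m -> 'rV[R]_n)
    (D : 'rV[R]_m -> 'rV[R]_n) (x : 'rV[R]_m) :
  (forall j, is_diff x (fun y => F y ord0 j) (fun v => D v ord0 j)) ->
  forall v, v *m 'J F x = D v.
Proof.
case/is_diff_row => dF_ dE v; rewrite -deriveEjacobian // deriveE // dE.
by apply/rowP => j; rewrite mxE.
Qed.

(** The pattern [?a] cannot mention the bound variable, so it catches constants only; what is left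
    is a coordinate. *)
Ltac diff_tac := lazymatch goal with
 | |- is_diff_def _ (fun y => - _) _ => apply: is_diff_oppf; diff_tac
 | |- is_diff_def _ (fun y => _ + _) _ => apply: is_diff_addf; diff_tac
 | |- is_diff_def _ (fun y => _ * _) _ => apply: is_diff_mulf; diff_tac
 | |- is_diff_def _ (fun y => sin _) _ => apply: is_diff_sinf; diff_tac
 | |- is_diff_def _ (fun y => cos _) _ => apply: is_diff_cosf; diff_tac
 | |- is_diff_def _ (fun y => _^-1) _ => apply: is_diff_invf => //; diff_tac
 | |- is_diff_def _ (fun y => ?a) _ => exact: is_diff_cstf
 | |- is_diff_def _ _ _ => exact: is_diff_coord
 end.

(** * Jacobians of the constraint and of the pursuit field *)

Section Jacobians.
Variable R : realType.
Implicit Types x v : 'rV[R]_7.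

Lemma mul_jacobian_constraint x v :
  v *m 'J (@constraint R) x =
  \row_(j < 2) nth 0
    [:: rho v - (rho1b v * cos (kappa1b x - kappa1 x)
          - rho1b x * sin (kappa1b x - kappa1 x) * (kappa1b v - kappa1 v))
        - (rho2b v * cos (kappa2b x - kappa2 x)
          - rho2b x * sin (kappa2b x - kappa2 x) * (kappa2b v - kappa2 v));
        rho1b v * sin (kappa1b x - kappa1 x)
          + rho1b x * cos (kappa1b x - kappa1 x) * (kappa1b v - kappa1 v)
        + (rho2b v * sin (kappa2b x - kappa2 x)
          + rho2b x * cos (kappa2b x - kappa2 x) * (kappa2b v - kappa2 v))] j.
Proof.
move: v; apply: mul_jacobian; move=> [[|[|//]] Hj] /=.
  rewrite (_ : (fun y => _) = @g1 R); last by apply/funext => y; rewrite mxE.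
  rewrite /g1 /=.
  eapply is_diff_eq; first by diff_tac.
  by apply/funext => w /=; rewrite mxE /= /rho /rho1b /rho2b /kappa1
    /kappa2 /kappa1b /kappa2b; ring.
rewrite (_ : (fun y => _) = @g2 R); last by apply/funext => y; rewrite mxE.
rewrite /g2 /=.
eapply is_diff_eq; first by diff_tac.
by apply/funext => w /=; rewrite mxE /= /rho /rho1b /rho2b /kappa1
    /kappa2 /kappa1b /kappa2b; ring.
Qed.

Lemma mul_jacobian_pursuit_field (mu lambda alpha0 alpha1 alpha2 : R) x v :
  rho x != 0 -> rho1b x != 0 -> rho2b x != 0 ->
  let S := sin (kappa1 x) + sin (kappa2 x) in
  let dS := cos (kappa1 x) * kappa1 v + cos (kappa2 x) * kappa2 v in
  let dkappa alpha k kb dk dkb :=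
    - (mu * ((1 - lambda) * cos (k - alpha) * dk
             + lambda * cos (kb - alpha0) * dkb))
    + lambda / rho x * dS - lambda / rho x ^+ 2 * S * rho v in
  let dkappab alpha k kb rb dk dkb drb :=
    dkappa alpha k kb dk dkb - dS / rho x + S / rho x ^+ 2 * rho v
    + cos kb / rb * dkb - sin kb / rb ^+ 2 * drb in
  v *m 'J (pursuit_field mu lambda alpha0 alpha1 alpha2) x =
  \row_(j < 7) nth 0
    [:: dkappa alpha1 (kappa1 x) (kappa1b x) (kappa1 v) (kappa1b v);
        dkappa alpha2 (kappa2 x) (kappa2b x) (kappa2 v) (kappa2b v);
        sin (kappa1 x) * kappa1 v + sin (kappa2 x) * kappa2 v;
        dkappab alpha1 (kappa1 x) (kappa1b x) (rho1b x)
          (kappa1 v) (kappa1b v) (rho1b v);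
        dkappab alpha2 (kappa2 x) (kappa2b x) (rho2b x)
          (kappa2 v) (kappa2b v) (rho2b v);
        sin (kappa1b x) * kappa1b v;
        sin (kappa2b x) * kappa2b v] j.
Proof.
move=> r0 r1 r2; cbv zeta; move: v; refine (@mul_jacobian R 7 7 _ _ x _) => j.
(* [reflexivity] fixes the unknown function to the formula of the j-th coordinate; [diff_tac] builds
   its differential, which is then compared with the claimed one. *)
case: j => [[|[|[|[|[|[|[|//]]]]]]] Hj];
  (apply: eq_is_diff => [y|]; first by rewrite mxE /=; reflexivity);
  (eapply is_diff_eq; first by diff_tac);
  apply/funext => w /=; rewrite mxE /=; move: r0 r1 r2;
  rewrite /rho /rho1b /rho2b /kappa1 /kappa2 /kappa1b /kappa2b => r0 r1 r2;
  have z0 : (0 : 'rV[R]_7 -> R) w = 0 by [];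
  rewrite ?z0; field; rewrite ?r0 ?r1 ?r2 //.
Qed.

End Jacobians.

Lemma mulmx_ext (F : pzSemiRingType) m n (A B : 'M[F]_(m, n)) :
  (forall u : 'rV_m, u *m A = u *m B) -> A = B.
Proof. by move=> AB; apply/row_matrixP => i; rewrite !rowE AB. Qed.

(** * Linearization at an equilibrium in adapted coordinates *)

Section Linearization.
Variables (R : realType) (mu lambda alpha0 alpha1 alpha2 : R) (x : 'rV[R]_7).
(* At the equilibria [e] is the sine of [kappa_ib], [d] that of the base
   angle of [kappa_i], [s] and [c] the sine and cosine of [alpha^-]. *)
Variables (e d w s c p q : R).
Hypotheses (e2 : e ^+ 2 = 1) (d2 : d ^+ 2 = 1) (w0 : w != 0) (c0 : c != 0).
Hypotheses (rhoE : rho x = 2 * e * d * c / w)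
  (rho1bE : rho1b x = w^-1) (rho2bE : rho2b x = w^-1).
Hypotheses (sin1 : sin (kappa1 x) = d * c) (cos1 : cos (kappa1 x) = - d * s)
  (sin2 : sin (kappa2 x) = d * c) (cos2 : cos (kappa2 x) = d * s)
  (sin1b : sin (kappa1b x) = e) (cos1b : cos (kappa1b x) = 0)
  (sin2b : sin (kappa2b x) = e) (cos2b : cos (kappa2b x) = 0).
Hypotheses (pE1 : mu * ((1 - lambda) * cos (kappa1 x - alpha1)) = p)
  (pE2 : mu * ((1 - lambda) * cos (kappa2 x - alpha2)) = p)
  (qE1 : mu * (lambda * cos (kappa1b x - alpha0)) = q)
  (qE2 : mu * (lambda * cos (kappa2b x - alpha0)) = q).

Let A := 'J (pursuit_field mu lambda alpha0 alpha1 alpha2) x.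
Let G := 'J (@constraint R) x.

Let e0 : e != 0. Proof. by apply/eqP => ee; move: e2; rewrite ee; lra. Qed.
Let d0 : d != 0. Proof. by apply/eqP => ee; move: d2; rewrite ee; lra. Qed.

Lemma row_coordsE (v : 'rV[R]_7) : v = \row_j nth 0
  [:: kappa1 v; kappa2 v; rho v; kappa1b v; kappa2b v; rho1b v; rho2b v] j.
Proof.
by apply/rowP => -[[|[|[|[|[|[|[|//]]]]]]] Hj]; rewrite mxE /=; congr (v _ _);
  apply/val_inj.
Qed.

(** At the equilibrium kappa_ib - kappa_i has cosine e d c, and sine - e d s for agent 1, e d s for
    agent 2. *)
Lemma mul_constraint_jacobian v : v *m G = \row_(j < 2) nth 0
  [:: rho v - e * d * c * (rho1b v + rho2b v)
      - e * d * s / w * ((kappa1b v - kappa1 v) - (kappa2b v - kappa2 v));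
      e * d * c / w * ((kappa1b v - kappa1 v) + (kappa2b v - kappa2 v))
      - e * d * s * (rho1b v - rho2b v)] j.
Proof.
rewrite mul_jacobian_constraint !cosB !sinB.
rewrite sin1 cos1 sin2 cos2 sin1b cos1b sin2b cos2b rho1bE rho2bE.
by apply/rowP => -[[|[|//]] Hj]; rewrite !mxE /=; ring.
Qed.

Lemma mul_field_jacobian v : v *m A = \row_(j < 7)
  let k1' := - (p * kappa1 v + q * kappa1b v)
      + lambda * (w * e * s / (2 * c)) * (kappa2 v - kappa1 v)
      - lambda * (w ^+ 2 * d / (2 * c)) * rho v in
  let k2' := - (p * kappa2 v + q * kappa2b v)
      + lambda * (w * e * s / (2 * c)) * (kappa2 v - kappa1 v)
      - lambda * (w ^+ 2 * d / (2 * c)) * rho v in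
  nth 0
  [:: k1'; k2'; d * c * (kappa1 v + kappa2 v);
      k1' - w * e * s / (2 * c) * (kappa2 v - kappa1 v)
      + w ^+ 2 * d / (2 * c) * rho v - e * w ^+ 2 * rho1b v;
      k2' - w * e * s / (2 * c) * (kappa2 v - kappa1 v)
      + w ^+ 2 * d / (2 * c) * rho v - e * w ^+ 2 * rho2b v;
      e * kappa1b v; e * kappa2b v] j.
Proof.
rewrite mul_jacobian_pursuit_field; last 3 first.
- by rewrite rhoE !mulf_neq0 ?invr_neq0 // pnatr_eq0.
- by rewrite rho1bE invr_neq0.
- by rewrite rho2bE invr_neq0.
have dE : d^-1 = d by apply: (mulfI d0); rewrite mulfV // -expr2.
have eE : e^-1 = e by apply: (mulfI e0); rewrite mulfV // -expr2.
(* [t1] and [t2] are the two coefficients in the linearization of (sin kappa_1 + sin kappa_2) /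
   rho. *)
have t1 : d * s / rho x = w * e * s / (2 * c).
  by rewrite rhoE -[in RHS]eE; field; rewrite ?w0 ?c0 ?e0 ?d0.
have t2 : 2 * (d * c) / rho x ^+ 2 = w ^+ 2 * d / (2 * c).
  have -> : rho x ^+ 2 = 4 * c ^+ 2 / w ^+ 2.
    rewrite rhoE; transitivity (4 * e ^+ 2 * d ^+ 2 * c ^+ 2 / w ^+ 2).
      by field.
    by rewrite e2 d2; field.
  by field; rewrite ?w0 ?c0.
have D1 : mu * ((1 - lambda) * cos (kappa1 x - alpha1) * kappa1 v
    + lambda * cos (kappa1b x - alpha0) * kappa1b v)
    = p * kappa1 v + q * kappa1b v.
  by rewrite -pE1 -qE1; ring.
have D2 : mu * ((1 - lambda) * cos (kappa2 x - alpha2) * kappa2 v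
    + lambda * cos (kappa2b x - alpha0) * kappa2b v)
    = p * kappa2 v + q * kappa2b v.
  by rewrite -pE2 -qE2; ring.
rewrite D1 D2 sin1 cos1 sin2 cos2 sin1b cos1b sin2b cos2b rho1bE rho2bE.
rewrite -t1 -t2 exprVn !invrK.
by apply/rowP => -[[|[|[|[|[|[|[|//]]]]]]] Hj]; rewrite !mxE /=; ring.
Qed.

Definition constraint_block : 'M[R]_2 :=
  mx_rows R 2 2 [:: [:: 0; e * w]; [:: - (e * w); 0]].

Definition difference_coords : 'M[R]_(7, 3) := mx_rows R 7 3
  [:: [:: 1; 0; 0]; [:: -1; 0; 0]; [:: 0; 0; 0]; [:: 0; 1; 0]; [:: 0; -1; 0];
      [:: 0; 0; 1]; [:: 0; 0; -1]].

Definition difference_block : 'M[R]_3 := mx_rows R 3 3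
  [:: [:: - p; - p; 0]; [:: - q; - q; e]; [:: 0; - (e * w ^+ 2); 0]].

Definition sum_coords : 'M[R]_(7, 2) := mx_rows R 7 2
  [:: [:: 1; 0]; [:: 1; 0]; [:: 0; 1]; [:: 0; 0]; [:: 0; 0];
      [:: 0; 0]; [:: 0; 0]].

Definition sum_block : 'M[R]_2 := mx_rows R 2 2
  [:: [:: - (p + q); d * c]; [:: - (lambda * (w ^+ 2 * d / c)); 0]].

Lemma mul_difference v : v *m difference_coords = \row_(j < 3) nth 0
  [:: kappa1 v - kappa2 v; kappa1b v - kappa2b v; rho1b v - rho2b v] j.
Proof.
rewrite {1}(row_coordsE v); apply/rowP => -[[|[|[|//]]] Hj];
  rewrite mxE !big_ord_recl big_ord0 !mxE /=; ring.
Qed.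

Lemma mul_sum v : v *m sum_coords = \row_(j < 2) nth 0
  [:: kappa1 v + kappa2 v; rho v] j.
Proof.
rewrite {1}(row_coordsE v); apply/rowP => -[[|[|//]] Hj];
  rewrite mxE !big_ord_recl big_ord0 !mxE /=; ring.
Qed.

Lemma field_mul_constraint : A *m G = G *m constraint_block.
Proof.
apply: mulmx_ext => v.
rewrite !mulmxA !mul_constraint_jacobian mul_field_jacobian.
apply/rowP => -[[|[|//]] Hj]; rewrite !mxE !big_ord_recl !big_ord0 /= !mxE /=
  /kappa1 /kappa2 /rho /kappa1b /kappa2b /rho1b /rho2b !mxE /=.
- by field: e2 d2; rewrite ?w0 ?c0.
- by field: e2 d2; rewrite ?w0 ?c0.
Qed.

(** The terms from (sin kappa_1 + sin kappa_2) / rho are common to both agents and cancel in the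
    differences. *)
Lemma field_mul_difference :
  A *m difference_coords = difference_coords *m difference_block.
Proof.
apply: mulmx_ext => v; rewrite !mulmxA !mul_difference mul_field_jacobian.
apply/rowP => -[[|[|[|//]]] Hj]; rewrite !mxE !big_ord_recl !big_ord0 /= !mxE /=
  /kappa1 /kappa2 /rho /kappa1b /kappa2b /rho1b /rho2b !mxE /=; ring.
Qed.

(** The derivative of kappa_1 + kappa_2 contains - q (kappa_1b + kappa_2b). Solving the linearized
    g2 for kappa_1b + kappa_2b replaces it by - q (kappa_1 + kappa_2), a multiple of g2 (this entry)
    and a multiple of rho_1b - rho_2b (last row of [difference_to_sum]). *)
Definition constraint_to_sum : 'M[R]_2 := mx_rows R 2 2
  [:: [:: 0; 0]; [:: - (q * w * e * d / c); 0]].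

Definition difference_to_sum : 'M[R]_(3, 2) := mx_rows R 3 2
  [:: [:: - (lambda * (w * e * s / c)); 0]; [:: 0; 0];
      [:: - (q * w * s / c); 0]].

Lemma field_mul_sum : A *m sum_coords = G *m constraint_to_sum
  + difference_coords *m difference_to_sum + sum_coords *m sum_block.
Proof.
apply: mulmx_ext => v; rewrite !mulmxDr !mulmxA !mul_difference !mul_sum.
rewrite mul_constraint_jacobian mul_field_jacobian.
apply/rowP => -[[|[|//]] Hj]; rewrite !mxE !big_ord_recl !big_ord0 /= !mxE /=
  /kappa1 /kappa2 /rho /kappa1b /kappa2b /rho1b /rho2b !mxE /=.
- by field: e2 d2; rewrite ?w0 ?c0.
- by ring.
Qed.

Definition adapted_coords : 'M[R]_(7, 2 + (3 + 2)) :=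
  row_mx G (row_mx difference_coords sum_coords).

Definition transverse_block : 'M[R]_(3 + 2) :=
  block_mx difference_block difference_to_sum 0 sum_block.

(** Sums and differences determine kappa_1, kappa_2 and rho; since e d c != 0, g2 then gives
    kappa_1b + kappa_2b and g1 gives rho_1b + rho_2b. *)
Lemma adapted_coords_free : row_free adapted_coords.
Proof.
apply: inj_row_free => v vT.
have : v *m adapted_coords = row_mx 0 (row_mx 0 0) by rewrite vT !row_mx0.
rewrite !mul_mx_row mul_constraint_jacobian mul_difference mul_sum.
case/eq_row_mx => /rowP g /eq_row_mx [/rowP dif /rowP sum].
have := g ord0; have := g ord_max; have := sum ord0; have := sum ord_max.
have := dif ord0; have := dif (Ordinal (isT : (1 < 3)%N)); have := dif ord_max.
rewrite !mxE /= => m0 b0 k0 r0 K0 g20 g10.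
have k1 : kappa1 v = 0 by lra.
have k2 : kappa2 v = 0 by lra.
have edc0 : e * d * c != 0 by rewrite !mulf_neq0.
have B0 : kappa1b v + kappa2b v = 0.
  apply: (mulfI edc0); apply: (mulIf (invr_neq0 w0)).
  rewrite mulr0 mul0r -g20 m0 k1 k2.
  by ring.
have P0 : rho1b v + rho2b v = 0.
  apply: (mulfI edc0); rewrite mulr0 -(oppr0 R) -g10 r0 k1 k2 !subr0 b0.
  by ring.
rewrite (row_coordsE v).
by apply/rowP => -[[|[|[|[|[|[|[|//]]]]]]] Hj]; rewrite !mxE /=; lra.
Qed.

Lemma field_mul_adapted : A *m adapted_coords =
  adapted_coords *m block_mx constraint_block (row_mx 0 constraint_to_sum)
    0 transverse_block.
Proof.
rewrite mul_row_block !mul_mx_row !mul_row_block field_mul_constraint.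
rewrite field_mul_difference field_mul_sum.
by rewrite !mulmx0 !addr0 add_row_mx add0r addrA.
Qed.

Lemma char_poly_field_jacobian :
  char_poly A = char_poly constraint_block * char_poly transverse_block.
Proof.
rewrite (char_poly_intertwine _ _ _ _ _ _ _ adapted_coords_free
  field_mul_adapted) //.
by rewrite char_poly_ublock.
Qed.

(** The columns of [G] are among those of the invertible [adapted_coords]: a relation between them,
    padded with zeros, lies in its kernel. *)
Lemma constraint_jacobian_free : row_free G^T.
Proof.
have Tunit := adapted_coords_free; rewrite row_free_unit in Tunit.
apply: inj_row_free => u uG.
have : adapted_coords *m col_mx u^T 0 = 0.
  rewrite mul_row_col mulmx0 addr0; apply: trmx_inj.
  by rewrite trmx_mul trmxK uG trmx0.
move=> /(congr1 (mulmx (invmx adapted_coords))); rewrite mulKmx // mulmx0 => u0.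
have [uT0 _] : u^T = 0 /\ (0 : 'M[R]_(3 + 2, 1)) = 0.
  by apply: eq_col_mx; rewrite u0 col_mx0.
by apply: trmx_inj; rewrite uT0 trmx0.
Qed.

Lemma char_poly_constraint_block :
  char_poly constraint_block = 'X^2 + 0%:P * 'X + (w ^+ 2)%:P.
Proof.
rewrite char_poly_rows2 mulrN -expr2 exprMn e2 !polyC0 polyCN; ring.
Qed.

Lemma char_poly_transverse_block : char_poly transverse_block =
  cubic R p q w * ('X^2 + (p + q)%:P * 'X + (lambda * w ^+ 2)%:P).
Proof.
rewrite char_poly_ublock char_poly_rows3 char_poly_rows2; congr (_ * _).
  have e2P : e%:P ^+ 2 = 1 :> {poly R} by rewrite -polyC_exp e2.
  rewrite /cubic !(polyCN, polyCD, polyCM, polyC_exp, polyC0); ring: e2P.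
have -> : d * c * - (lambda * (w ^+ 2 * d / c)) = - (lambda * w ^+ 2).
  by field: d2.
by rewrite !(polyCN, polyCD, polyCM, polyC0); ring.
Qed.

(** The quadratic factor adds no condition: once p, q > 0 its coefficients p + q and lambda w^2 are
    positive. *)
Lemma transverse_roots : 0 < w -> 0 < lambda ->
  (forall z, root (map_poly (real_complex R) (char_poly transverse_block)) z ->
     complex.Re z < 0) <-> 0 < p /\ 0 < q.
Proof.
move=> w_gt0 l_gt0; rewrite char_poly_transverse_block rmorphM /=.
rewrite -(cubic_roots R p q w w_gt0); split=> H z.
  by move=> rz; apply: H; rewrite rootM rz.
rewrite rootM => /orP [/H //|].
have [p0 q0] := (cubic_roots R p q w w_gt0).1 H.
apply: root_quadratic_lt0; first by rewrite addr_gt0.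
by rewrite mulr_gt0 // exprn_gt0.
Qed.

Lemma linearized_spectrum : 0 < w -> 0 < lambda ->
  [/\ stablemx (kermx G) A, \rank (cokermx (kermx G)) = 2%N
    & exists (z1 z2 : R[i]) (t : 5.-tuple R[i]),
      [/\ spectrum (quotient_endo (kermx G) A) [:: z1; z2],
          pure_imaginary z1, pure_imaginary z2, spectrum A [:: z1, z2 & t]
        & (forall z, z \in t -> complex.Re z < 0) <-> 0 < p /\ 0 < q]].
Proof.
move=> w_gt0 l_gt0.
have [stabK rankK charK] :=
  factor_kermx _ _ _ _ _ _ constraint_jacobian_free field_mul_constraint.
split=> //.
have [t tE] := spectrum_exists _ _ transverse_block.
(* The roots i w and - i w of X^2 + w^2. *)
pose z1 : R[i] := Complex 0 w; pose z2 : R[i] := Complex 0 (- w).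
have cE : map_poly (real_complex R) (char_poly constraint_block) =
    ('X - z1%:P) * ('X - z2%:P).
  rewrite char_poly_constraint_block polyC0 mul0r addr0 rmorphD /= map_polyXn.
  rewrite map_polyC /=.
  have sum0 : z1 + z2 = 0.
    by apply/eqP; rewrite eq_complex /= addr0 addrN !eqxx.
  have prodE : z1 * z2 = real_complex R (w ^+ 2).
    by apply/eqP; rewrite eq_complex /=; apply/andP; split; apply/eqP; ring.
  transitivity ('X^2 - (z1 + z2)%:P * 'X + (z1 * z2)%:P).
    by rewrite sum0 prodE polyC0 mul0r subr0.
  by rewrite polyCD polyCM; ring.
exists z1, z2, t; split.
- by rewrite /spectrum -map_char_poly charK cE !big_cons big_nil mulr1.
- by split=> //=; rewrite gt_eqF.
- by split=> //=; rewrite oppr_eq0 gt_eqF.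
- rewrite /spectrum -map_char_poly char_poly_field_jacobian rmorphM /= cE.
  by rewrite !big_cons mulrA map_char_poly tE.
rewrite -transverse_roots //.
have memt z := mem_spectrum _ _ _ _ z tE.
by split=> H z; [rewrite -memt|rewrite memt]; exact: H.
Qed.

End Linearization.

(** * Trigonometric values at the circling equilibria *)

Lemma eq_angle_trig (R : realType) (a b : R) :
  eq_angle a b -> cos a = cos b /\ sin a = sin b.
Proof.
have shift (n : nat) (t : R) : cos (t + (pi *+ 2) *+ n) = cos t
    /\ sin (t + (pi *+ 2) *+ n) = sin t.
  by rewrite (periodicn (@cosD2pi R)) (periodicn (@sinD2pi R)).
case=> [[n|n] ->].
  by rewrite -pmulrn mulr_natr mulr_natl; exact: shift.
(* [Negz n] is - (n + 1), so n + 1 full turns are added back. *)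
have [cE sE] := shift n.+1 (b + 2 * pi * (Negz n)%:~R).
suff E : b + 2 * pi * (Negz n)%:~R + pi *+ 2 *+ n.+1 = b
  by rewrite -cE -sE E.
by rewrite NegzE mulrNz -pmulrn; ring.
Qed.

Section Equilibrium.
Variables (R : realType) (c : circling).

(** These two signs are the [e] and [d] of the linearization; they encode the four types. *)
Definition beacon_sign : R := sin (circling_kappab R c).
Definition bearing_sign : R := sin (circling_kappa R c).

Lemma signsE : beacon_sign = match c with Type1CCW | Type2CCW => 1 | _ => -1 end
  /\ bearing_sign = match c with Type1CCW | Type2CW => 1 | _ => -1 end.
Proof.
by rewrite /beacon_sign /bearing_sign; case: c => /=; rewrite ?sinN sin_pihalf.
Qed.

Lemma sign_sqr : beacon_sign ^+ 2 = 1 /\ bearing_sign ^+ 2 = 1.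
Proof. by have [-> ->] := signsE; case: c; rewrite ?sqrrN expr1n. Qed.

Lemma beacon_trig (k alpha0 : R) : eq_angle k (circling_kappab R c) ->
  [/\ cos k = 0, sin k = beacon_sign
    & cos (k - alpha0) = beacon_sign * sin alpha0].
Proof.
case/eq_angle_trig => ck sk.
have c0 : cos k = 0.
  by rewrite ck; case: (c) => /=; rewrite ?cosN cos_pihalf.
by split=> //; rewrite ?cosB ?c0 ?mul0r ?add0r sk.
Qed.

Lemma bearing_trig (k a : R) : eq_angle k (circling_kappa R c + a) ->
  cos k = - (bearing_sign * sin a) /\ sin k = bearing_sign * cos a.
Proof.
have c0 : cos (circling_kappa R c) = 0.
  by case: (c) => /=; rewrite ?cosN cos_pihalf.
by case/eq_angle_trig => -> ->; rewrite cosD sinD c0 !mul0r sub0r addr0.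
Qed.

End Equilibrium.

(** * Stability of the four kinds of equilibria *)

Theorem proposition5p1 (R : realType) (mu lambda alpha0 alpha1 alpha2 : R)
    (c : circling) (xi : 'rV[R]_7) :
  let alphap := (alpha1 + alpha2) / 2 in
  let A := 'J (pursuit_field mu lambda alpha0 alpha1 alpha2) xi in
  let K := kermx ('J (@constraint R) xi) in
  0 < mu -> 0 < lambda < 1 -> sin (2 * alphap) != 0 ->
  0 < rho xi -> 0 < rho1b xi -> 0 < rho2b xi ->
  circling_equilibrium c mu lambda alpha0 alpha1 alpha2 xi ->
  [/\ stablemx K A,
      \rank (cokermx K) = 2%N
    & exists (z1 z2 : R[i]) (s : 5.-tuple R[i]),
        [/\ spectrum (quotient_endo K A) [:: z1; z2],
            pure_imaginary z1,
            pure_imaginary z2,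
            spectrum A [:: z1, z2 & s]
          & (forall z, z \in s -> complex.Re z < 0) <->
            match c with
            | Type1CCW => 0 < sin alpha0 /\ 0 < sin alphap
            | Type1CW => sin alpha0 < 0 /\ sin alphap < 0
            | Type2CCW => 0 < sin alpha0 /\ sin alphap < 0
            | Type2CW => sin alpha0 < 0 /\ 0 < sin alphap
            end]].
Proof.
move=> alphap A K mu0 /andP [l0 l1] _ r0 r1 r2 [ex rhoE [rho1bE rho2bE]].
case=> kb1 kb2 [k1 k2].
set alpham := (alpha1 - alpha2) / 2 in ex rhoE k1 k2.
have [cb1 sb1 cb1a] := beacon_trig R c _ alpha0 kb1.
have [cb2 sb2 cb2a] := beacon_trig R c _ alpha0 kb2.
have [c1 s1] := bearing_trig R c _ _ k1.
have [c2 s2] := bearing_trig R c _ _ k2.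
rewrite cosN in s2; rewrite sinN mulrN opprK in c2; rewrite -mulNr in c1.
set e := beacon_sign R c in sb1 cb1a sb2 cb2a.
set d := bearing_sign R c in c1 s1 c2 s2.
have [e2 d2] : e ^+ 2 = 1 /\ d ^+ 2 = 1 := sign_sqr R c.
pose w := (rho1b xi)^-1.
have w0 : 0 < w by rewrite invr_gt0.
have r1w : rho1b xi = w^-1 by rewrite /w invrK.
have r2w : rho2b xi = w^-1 by rewrite rho2bE -rho1bE.
have cm0 : cos alpham != 0.
  by case: (c) ex => -[] c0 _; rewrite ?(gt_eqF c0) ?(lt_eqF c0).
(* The product e d is 1 for Type 1 and -1 for Type 2, which accounts for the sign in
   [circling_rho]. *)
have rw : rho xi = 2 * e * d * cos alpham / w.
  rewrite -[_ / w]/(_ * w^-1) -r1w rho1bE rhoE /e /d.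
  have [-> ->] := signsE R c; case: (c) => /=; ring.
(* Both agents yield the same p because alpha_1 - alpha^- = alpha_2 + alpha^- = alpha^+. *)
have pE1 : mu * ((1 - lambda) * cos (kappa1 xi - alpha1)) =
    mu * ((1 - lambda) * (d * sin alphap)).
  have -> : alphap = alpha1 - alpham by rewrite /alphap /alpham; field.
  by rewrite cosB c1 s1 sinB; ring.
have pE2 : mu * ((1 - lambda) * cos (kappa2 xi - alpha2)) =
    mu * ((1 - lambda) * (d * sin alphap)).
  have -> : alphap = alpha2 + alpham by rewrite /alphap /alpham; field.
  by rewrite cosB c2 s2 sinD; ring.
have qE1 : mu * (lambda * cos (kappa1b xi - alpha0)) =
  mu * (lambda * (e * sin alpha0)) by rewrite cb1a.
have qE2 : mu * (lambda * cos (kappa2b xi - alpha0)) =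
  mu * (lambda * (e * sin alpha0)) by rewrite cb2a.
have [stabK rankK [z1 [z2 [s [sQ im1 im2 sA sE]]]]] := linearized_spectrum
  _ _ _ _ _ _ _ _ _ _ _ _ _ _ e2 d2 (lt0r_neq0 w0) cm0 rw r1w r2w
  s1 c1 s2 c2 sb1 cb1 sb2 cb2 pE1 pE2 qE1 qE2 w0 l0.
split=> //; exists z1, z2, s; split=> //; rewrite sE.
have l1' : 0 < 1 - lambda by rewrite subr_gt0.
(* Dropping positive factors leaves d sin alpha^+ > 0 and e sin alpha_0 > 0, to be read off for each
   type. *)
rewrite !(pmulr_rgt0 _ mu0) (pmulr_rgt0 _ l0) (pmulr_rgt0 _ l1') /e /d.
have [-> ->] := signsE R c.
by case: (c); rewrite ?mul1r ?mulN1r ?oppr_gt0; split=> -[].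
Qed.
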